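(* Let $q$ be a prime power, fix non-negative integers $n,k$, and for an integer $\ell\ge 0$ with $k-\ell$ even let $c=(k-\ell)/2$ (the number of pre-shared ebits of the entanglement-assisted quantum code associated to an $[2n,k]_q$ code with symplectic hull dimension $\ell$). For $\ell+2\le k\le 2n-\ell-2$ with $k-\ell$ even, the number $A^S_{2n,k,\ell,q}$ of such classical codes satisfies $$A^S_{2n,k,\ell,q}=\alpha^S_{2n,k,\ell,q}\,(q^{\ell+1}-1)(q^{\ell+2}-1)\,A^S_{2n,k,\ell+2,q},\qquad \alpha^S_{2n,k,\ell,q}=\frac{q^{a+b-2}}{(q^a-1)(q^b-1)},$$ where $a=k-\ell$ and $b=2n-k-\ell$. Consequently, outside the family $$\mathcal{E}_S=\{(2n,k,0,2):4\le k\le 2n-4,\ k\text{ even}\},$$ $A^S_{2n,k,\ell,q}$ is strictly decreasing in $\ell$ (equivalently, strictly increasing in $c$); that is, $A^S_{2n,k,\ell,q}>A^S_{2n,k,\ell+2,q}$ whenever $(2n,k,\ell,q)\notin\mathcal{E}_S$. On $\mathcal{E}_S$ (that is, for $q=2$, $\ell=0$, $4\le k\le 2n-4$, $k$ even) the dependence reverses: the family with $c=k/2$ is outnumbered by the family with $c=(k-2)/2$, i.e. $A^S_{2n,k,0,2}<A^S_{2n,k,2,2}$.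
   Context: For a prime power $q$, the symplectic inner product on $\mathbb{F}_q^{2n}$ is $\langle\mathbf{x},\mathbf{y}\rangle_S=\sum_{i=1}^n(x_iy_{n+i}-x_{n+i}y_i)$. For a linear subspace $C\subseteq\mathbb{F}_q^{2n}$, its symplectic dual is $C^{\perp_S}=\{\mathbf{y}\in\mathbb{F}_q^{2n}:\langle\mathbf{x},\mathbf{y}\rangle_S=0\ \forall\mathbf{x}\in C\}$ and its symplectic hull is $\mathrm{Hull}_S(C)=C\cap C^{\perp_S}$. An $[2n,k]_q$ code is a $k$-dimensional subspace of $\mathbb{F}_q^{2n}$. The number $A^S_{2n,k,\ell,q}$ is the number of $k$-dimensional subspaces $C\subseteq\mathbb{F}_q^{2n}$ with $\dim\mathrm{Hull}_S(C)=\ell$. By the Wilde–Brun construction, an $[2n,k]_q$ code with symplectic hull dimension $\ell$ gives an entanglement-assisted stabilizer code of length $n$ using $c=(k-\ell)/2$ pre-shared ebits; in this statement only the numerical value $c=(k-\ell)/2$ is used, as a relabelling of $\ell$. *)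

(* Defs.v *)
From HB Require Import structures.
From mathcomp Require Import all_boot all_order all_algebra.

Set Implicit Arguments.
Unset Strict Implicit.
Unset Printing Implicit Defensive.

Import Order.TTheory GRing.Theory Num.Theory.
Local Open Scope ring_scope.

(* The library does not make the type of subspaces over a finite field finite;
   a subspace is encoded by a canonical matrix, so finiteness is inherited. *)
HB.instance Definition _ (F : finFieldType) (vT : vectType F) :
    isCountable {vspace vT} :=
  CanIsCountable (@VectorInternalTheory.vs2mxK F vT).
HB.instance Definition _ (F : finFieldType) (vT : vectType F) :
    isFinite {vspace vT} :=
  CanIsFinite (@VectorInternalTheory.vs2mxK F vT).

Section Symplectic.

Variables (F : finFieldType) (n : nat).

(* F_q^{2n} is 'rV[F]_(n + n), so that lshift/rshift give the indices i and
   n + i. *)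
Notation V := 'rV[F]_(n + n).

Definition sympl_form (x y : V) : F :=
  \sum_(i < n) (x 0 (lshift n i) * y 0 (rshift n i)
                - x 0 (rshift n i) * y 0 (lshift n i)).

Fact sympl_form_is_linear x : linear_for *%R (sympl_form x).
Proof.
move=> a u v; rewrite /sympl_form mulr_sumr -big_split /=.
apply: eq_bigr => i _; rewrite !mxE mulrBr.
by rewrite !mulrDr opprD addrACA !(mulrCA a).
Qed.

HB.instance Definition _ x :=
  GRing.isLinear.Build F V F *%R (sympl_form x) (sympl_form_is_linear x).

(* As the common kernel of the functionals <x, .>, x \in C; memv_sympl_dual
   below is the defining property. *)
Definition sympl_dual (C : {vspace V}) : {vspace V} :=
  (\bigcap_(x : V | x \in C) lker (linfun (sympl_form x : V -> F^o)))%VS.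

Lemma memv_sympl_dual (C : {vspace V}) (y : V) :
  reflect (forall x, x \in C -> sympl_form x y = 0) (y \in sympl_dual C).
Proof.
have kerE x : (y \in lker (linfun (sympl_form x : V -> F^o)))
              = (sympl_form x y == 0).
  have lin : linear (sympl_form x : V -> F^o) := sympl_form_is_linear x.
  pose f : {linear V -> F^o} := HB.pack (sympl_form x : V -> F^o)
    (GRing.isLinear.Build F V F^o *:%R (sympl_form x : V -> F^o) lin).
  by rewrite memv_ker (lfunE f).
apply: (iffP idP) => [yC x xC | yC].
  apply/eqP; rewrite -kerE; apply: subvP yC; exact: bigcapv_inf xC (subvv _).
rewrite memvE; apply/subv_bigcapP => x xC.
by rewrite -memvE kerE yC.
Qed.

Definition sympl_hull (C : {vspace V}) : {vspace V} := (C :&: sympl_dual C)%VS.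

End Symplectic.

(* A^S_{2n,k,l,q} with q = #|F| *)
Definition num_sympl_hull (F : finFieldType) (n k l : nat) : nat :=
  #|[set C : {vspace 'rV[F]_(n + n)} |
      (\dim C == k) && (\dim (sympl_hull C) == l)]|.

(* The same count indexed by the number c = (k - l) / 2 of pre-shared ebits,
   written l + 2c = k to avoid truncated operations. *)
Definition num_sympl_ebits (F : finFieldType) (n k c : nat) : nat :=
  #|[set C : {vspace 'rV[F]_(n + n)} |
      (\dim C == k) && (\dim (sympl_hull C) + 2 * c == k)%N]|.

(* alpha^S_{2n,k,l,q}; the subtractions in nat are exact when
   l + 2 <= k <= 2n - l - 2. *)
Definition alphaS (n k l q : nat) : rat :=
  let a := (k - l)%N in
  let b := (2 * n - k - l)%N in
  q%:R ^+ (a + b - 2) / ((q%:R ^+ a - 1) * (q%:R ^+ b - 1)).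

(* Quadruples (2n, k, l, q); k <= N - 4 is not affected by truncation as
   4 <= k. *)
Definition E_S : pred (nat * nat * nat * nat) :=
  fun '(N, k, l, q) =>
    [&& ~~ odd N, l == 0, q == 2, 4 <= k, k <= N - 4 & ~~ odd k]%N.

(* Main.v *)
From HB Require Import structures.
Require Import Defs.
From mathcomp Require Import all_boot all_order all_algebra finfield.
From mathcomp Require Import zify ring.

Set Implicit Arguments.
Unset Strict Implicit.
Unset Printing Implicit Defensive.

Import Order.TTheory GRing.Theory Num.Theory.
Local Open Scope ring_scope.

(** The recursion comes from a double count, with no closed formula for the
    number of codes.  Write N = 2n, let ^ denote the symplectic dual, and call
    a flag a triple (C, u, v) with v in C and <u, v> <> 0.  Such a triple
    cuts C into the hyperplane W = C cap u^ and the line spanned by v, and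
    swapping (C, u, v) with (W^, v, u) is an involution: dualising exchanges
    cutting by u with adjoining u.

    Adjoining v to W moves the dimension of the hull by exactly one.  It
    increases when v is in Hull(W)^ = W + W^, and decreases otherwise; and v
    is in Hull(W)^ exactly when u is not in Hull(C)^
    (memv_sympl_dual_hull_adjoin, dim_sympl_hull_adjoin).  Since W and W^ have
    the same hull, the involution exchanges the flags of dimension k + 1,
    hull dimension l + 1 and u outside Hull(C)^ with those of dimension
    N - k, hull dimension l and u inside Hull(C)^.  For fixed C the
    number of pairs (u, v) is a product of two differences of powers of q, so
    this is a relation between A(k + 1, l + 1) and A(N - k, l) = A(k, l)
    (num_sympl_hull_up), and replacing codes by their duals relates
    A(k + 1, l) to A(k, l + 1) (num_sympl_hull_down).  Both A(k, l) and
    A(k, l + 2) are thus multiples of A(k - 1, l + 1), and the quotient of the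
    two factors is the stated one (num_sympl_hull_ratio).

    The same two relations, started from the zero code, show that A(k, l) > 0
    in the whole admissible range (num_sympl_hull_gt0), so a ratio different
    from 1 gives a strict inequality.  Comparing q^(a+b-2) (q^(l+1) - 1)
    (q^(l+2) - 1) with (q^a - 1) (q^b - 1) is elementary: the former is at
    least q^(a+b) unless q = 2 and l = 0, and in that case, with x = 2^a and
    y = 2^b, the comparison of 3xy/4 with (x - 1)(y - 1) is decided by the
    sign of (x - 4)(y - 4) - 12.  Here a and b are even, so only a = 2 or
    b = 2 keeps the inequality, which is the complement of the exceptional
    family. *)

(** * Symplectic duality *)

Section SymplecticGeometry.

Variables (F : finFieldType) (n : nat).
Notation V := 'rV[F]_(n + n).
Implicit Types (U W C : {vspace V}) (u v w x y : V).

Lemma sympl_formC x y : sympl_form x y = - sympl_form y x.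
Proof.
rewrite /sympl_form -sumrN; apply: eq_bigr => i _.
by rewrite opprB [X in X - _]mulrC [X in _ - X]mulrC.
Qed.

Lemma sympl_form_eq0C x y : (sympl_form x y == 0) = (sympl_form y x == 0).
Proof. by rewrite sympl_formC oppr_eq0. Qed.

Lemma sympl_formxx x : sympl_form x x = 0.
Proof.
by rewrite /sympl_form big1 // => i _; rewrite mulrC subrr.
Qed.

Lemma sympl_form_nondegenerate x : (forall y, sympl_form x y = 0) -> x = 0.
Proof.
have pick_term (c : 'I_n -> F) i : \sum_j c j * (j == i)%:R = c i.
  rewrite (bigD1 i) //= eqxx mulr1 big1 ?addr0 // => j /negPf->.
  by rewrite mulr0.
move=> x0; apply/rowP => i; rewrite mxE; case: (split_ordP i) => {i} i ->.
  transitivity (sympl_form x (delta_mx 0 (rshift n i))); last exact: x0.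
  rewrite -[LHS](pick_term (fun j => x 0 (lshift n j))).
  apply: eq_bigr => j _; rewrite !mxE eqxx /= eq_lrshift mulr0 subr0.
  by rewrite (inj_eq (@rshift_inj _ _)).
apply: oppr_inj; rewrite oppr0.
transitivity (sympl_form x (delta_mx 0 (lshift n i))); last exact: x0.
rewrite -[in LHS](pick_term (fun j => x 0 (rshift n j))) -sumrN.
apply: eq_bigr => j _; rewrite !mxE eqxx /= eq_rlshift mulr0 sub0r.
by rewrite (inj_eq (@lshift_inj _ _)).
Qed.

Lemma memv_sympl_dual_line u y :
  (y \in sympl_dual <[u]>) = (sympl_form u y == 0).
Proof.
apply/memv_sympl_dual/eqP => [-> | uy x /vlineP[a ->]]; rewrite ?memv_line //.
by rewrite sympl_formC linearZ /= sympl_formC uy oppr0 mulr0 oppr0.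
Qed.

Lemma sympl_dualS U W : (U <= W)%VS -> (sympl_dual W <= sympl_dual U)%VS.
Proof.
move=> /subvP UW; apply/subvP => y /memv_sympl_dual Wy.
by apply/memv_sympl_dual => x /UW/Wy.
Qed.

Lemma sub_sympl_dualC U W :
  (U <= sympl_dual W)%VS = (W <= sympl_dual U)%VS.
Proof.
apply/idP/idP => /subvP h; apply/subvP => x xU; apply/memv_sympl_dual => y yU;
  by rewrite sympl_formC (memv_sympl_dual _ _ (h _ yU)) ?oppr0.
Qed.

Lemma sympl_dualD U W :
  sympl_dual (U + W) = (sympl_dual U :&: sympl_dual W)%VS.
Proof.
apply/eqP; rewrite eqEsubv subv_cap !sympl_dualS ?addvSl ?addvSr //=.
by rewrite sub_sympl_dualC subv_add -!(sub_sympl_dualC (_ :&: _)%VS)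
           capvSl capvSr.
Qed.

Lemma dim_cap_sympl_dual_line U u :
  (\dim (U :&: sympl_dual <[u]>) + (u \notin sympl_dual U) = \dim U)%N.
Proof.
pose f := linfun (sympl_form u : V -> F^o).
have lin : linear (sympl_form u : V -> F^o) := sympl_form_is_linear u.
pose g : {linear V -> F^o} := HB.pack (sympl_form u : V -> F^o)
  (GRing.isLinear.Build F V F^o *:%R (sympl_form u : V -> F^o) lin).
have kerE : sympl_dual <[u]> = lker f.
  by apply/vspaceP => y; rewrite memv_sympl_dual_line memv_ker (lfunE g).
rewrite -(limg_ker_dim f U) -kerE; congr (_ + _)%N.
have: (\dim (f @: U) <= 1)%N.
  by rewrite (leq_trans (dimvS (subvf _))) // dimvf /= /dim /=.
have <- : (\dim (f @: U) == 0)%N = (u \in sympl_dual U).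
  by rewrite dimv_eq0 -lkerE -kerE sub_sympl_dualC memvE.
by case: (\dim _) => [|[]].
Qed.

Lemma dim_sympl_space : \dim (fullv : {vspace V}) = (n + n)%N.
Proof. by rewrite dimvf dim_matrix mul1r. Qed.

(** Each vector of a basis of U imposes one linear condition, which costs at
    most one dimension. *)
Lemma dim_sympl_dual_ge U : (n + n <= \dim (sympl_dual U) + \dim U)%N.
Proof.
suff span_ge (s : seq V) : (n + n <= \dim (sympl_dual <<s>>) + size s)%N.
  by have := span_ge (vbasis U); rewrite size_tuple (span_basis (vbasisP U)).
elim: s => [|v s IHs] /=.
  have dual0 : sympl_dual 0 = fullv :> {vspace V}.
    apply/vspaceP => y; rewrite memvf; apply/memv_sympl_dual => x.
    by rewrite memv0 => /eqP->; rewrite sympl_formC linear0 oppr0.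
  by rewrite addn0 span_nil dual0 dim_sympl_space.
rewrite span_cons sympl_dualD capvC.
have := dim_cap_sympl_dual_line (sympl_dual <<s>>) v.
by move: IHs; case: (_ \notin _); lia.
Qed.

(** The opposite bound comes from a complement of U: the duals of U and of
    its complement meet in 0 because the form is nondegenerate, and
    the previous bound applies to both. *)
Lemma dim_sympl_dual U : (\dim (sympl_dual U) + \dim U = n + n)%N.
Proof.
apply/eqP; rewrite eqn_leq dim_sympl_dual_ge andbT.
have disj : (sympl_dual U :&: sympl_dual U^C = 0)%VS.
  apply/eqP; rewrite -subv0 -sympl_dualD addv_complf; apply/subvP => y y0.
  rewrite memv0; apply/eqP/sympl_form_nondegenerate => x.
  by rewrite sympl_formC (memv_sympl_dual _ _ y0) ?memvf ?oppr0.
have := dim_sympl_dual_ge U^C; have := dimv_compl U.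
have := dimvS (subvf (sympl_dual U + sympl_dual U^C)%VS).
have := dimvS (subvf U).
rewrite (dimv_disjoint_sum disj) dim_sympl_space; lia.
Qed.

Lemma sympl_dualK : involutive (@sympl_dual F n).
Proof.
move=> U; apply/eqP; rewrite eq_sym eqEdim sub_sympl_dualC subvv /=.
have := dim_sympl_dual U; have := dim_sympl_dual (sympl_dual U); lia.
Qed.

Lemma sympl_dual_hull U : sympl_dual (sympl_hull U) = (U + sympl_dual U)%VS.
Proof. by rewrite -[RHS]sympl_dualK sympl_dualD sympl_dualK capvC. Qed.

(** * Hulls and hyperplanes *)

(** In this part W is the hyperplane u^ of the space C = W + <[v]>.  If v is
    not orthogonal to some h in the hull of W, pairing with h shows that the
    hull of C stays inside W, hence orthogonal to u.  If v is orthogonal to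
    that hull, then v = w + x with w in W and x in its dual, and x is a new
    vector of the hull of C, on which u takes the value <u, v> <> 0. *)
Lemma memv_sympl_dual_hull_adjoin W u v :
    u \in sympl_dual W -> sympl_form u v != 0 ->
  (u \in sympl_dual (sympl_hull (W + <[v]>)))
    = (v \notin sympl_dual (sympl_hull W)).
Proof.
move=> uW uv; set C := (W + <[v]>)%VS; apply/idP/idP.
  apply: contraL; rewrite [sympl_dual (sympl_hull W)]sympl_dual_hull.
  case/memv_addP => w wW [x xW v_eq].
  have ux : sympl_form u x != 0.
    move: uv; rewrite v_eq linearD /= sympl_formC.
    by rewrite (memv_sympl_dual _ _ uW) ?oppr0 ?add0r.
  have xC : x \in sympl_hull C.
    have vC : v \in C by rewrite -[v]add0r memv_add ?mem0v ?memv_line.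
    have wC : w \in C by rewrite (subvP (addvSl _ _)).
    have xCC : x \in C by rewrite -[x](addKr w) -v_eq rpredD ?rpredN.
    rewrite memv_cap xCC sympl_dualD memv_cap xW memv_sympl_dual_line v_eq.
    rewrite sympl_formC linearD /= sympl_formxx addr0 oppr_eq0 sympl_formC.
    by rewrite (memv_sympl_dual _ _ xW) ?oppr0.
  apply: contraNN ux => /memv_sympl_dual/(_ x xC).
  by rewrite sympl_form_eq0C => ->.
rewrite memvE sub_sympl_dualC => /subvPn[h]; rewrite memv_cap => /andP[hW hWd].
rewrite memv_sympl_dual_line => vh.
apply: (subvP (sympl_dualS _)) uW; apply/subvP => y; rewrite memv_cap.
case/andP=> /memv_addP[w wW [_ /vlineP[a ->] ->]] /memv_sympl_dual yd.
have := yd h (subvP (addvSl _ _) _ hW); rewrite linearD linearZ /=.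
rewrite [sympl_form h w]sympl_formC (memv_sympl_dual _ _ hWd) // oppr0 add0r.
move/eqP; rewrite mulf_eq0 sympl_form_eq0C (negPf vh) orbF => /eqP->.
by rewrite scale0r addr0.
Qed.

Lemma cap_adjoin_sympl_dual_line W u v :
    u \in sympl_dual W -> sympl_form u v != 0 ->
  ((W + <[v]>) :&: sympl_dual <[u]>)%VS = W.
Proof.
move=> uW uv; apply/eqP; rewrite eqEsubv subv_cap addvSl /=.
rewrite sub_sympl_dualC -memvE uW andbT; apply/subvP => y; rewrite memv_cap.
case/andP=> /memv_addP[w wW [_ /vlineP[a ->] ->]].
rewrite memv_sympl_dual_line linearD linearZ /= sympl_formC.
rewrite (memv_sympl_dual _ _ uW) // oppr0 add0r mulf_eq0 (negPf uv) orbF.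
by move/eqP->; rewrite scale0r addr0.
Qed.

Lemma adjoin_cap_sympl_dual_line C u v :
    v \in C -> sympl_form u v != 0 ->
  (C :&: sympl_dual <[u]> + <[v]>)%VS = C.
Proof.
move=> vC uv; apply/eqP; rewrite eqEsubv subv_add capvSl -memvE vC /=.
apply/subvP => y yC; pose a := sympl_form u y / sympl_form u v.
rewrite -[y](subrK (a *: v)) memv_add ?rpredZ ?memv_line //.
rewrite memv_cap rpredB ?rpredZ // memv_sympl_dual_line linearB linearZ /=.
by rewrite divfK // subrr.
Qed.

Lemma dim_adjoin W u v :
    u \in sympl_dual W -> sympl_form u v != 0 ->
  \dim (W + <[v]>) = (\dim W).+1.
Proof.
move=> uW uv; have := dim_cap_sympl_dual_line (W + <[v]>)%VS u.
rewrite cap_adjoin_sympl_dual_line // sympl_dualD memv_cap uW /=.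
by rewrite memv_sympl_dual_line sympl_form_eq0C uv addn1.
Qed.

(** The vectors of the hull of C orthogonal to u are those of the hull of W
    orthogonal to v.  Each hull exceeds this common subspace by at most one
    dimension, and memv_sympl_dual_hull_adjoin says that exactly one of them
    does. *)
Lemma dim_sympl_hull_adjoin W u v :
    u \in sympl_dual W -> sympl_form u v != 0 ->
  (\dim (sympl_hull (W + <[v]>)) + (v \notin sympl_dual (sympl_hull W))
   = \dim (sympl_hull W) + (v \in sympl_dual (sympl_hull W)))%N.
Proof.
move=> uW uv; set C := (W + <[v]>)%VS.
have capE : (sympl_hull C :&: sympl_dual <[u]>
             = sympl_hull W :&: sympl_dual <[v]>)%VS.
  rewrite /sympl_hull -capvA [(sympl_dual C :&: _)%VS]capvC capvA.
  by rewrite cap_adjoin_sympl_dual_line // sympl_dualD capvA.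
have := dim_cap_sympl_dual_line (sympl_hull C) u.
have := dim_cap_sympl_dual_line (sympl_hull W) v.
rewrite memv_sympl_dual_hull_adjoin // capE negbK.
by case: (_ \in _) => /=; lia.
Qed.

Lemma sympl_hull_dual U : sympl_hull (sympl_dual U) = sympl_hull U.
Proof. by rewrite /sympl_hull sympl_dualK capvC. Qed.

(** Taking the dual of the hyperplane makes the map its own inverse: C is
    recovered by adjoining v, which after dualising is again cutting, by v. *)
Definition swap_flag (p : {vspace V} * (V * V)) : {vspace V} * (V * V) :=
  (sympl_dual (p.1 :&: sympl_dual <[p.2.1]>), (p.2.2, p.2.1)).

Lemma swap_flag_spec C u v (D := (swap_flag (C, (u, v))).1) :
    v \in C -> sympl_form u v != 0 ->
  [/\ swap_flag (swap_flag (C, (u, v))) = (C, (u, v)),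
      (\dim C + \dim D = (n + n).+1)%N,
      (v \in sympl_dual (sympl_hull D)) = (u \notin sympl_dual (sympl_hull C)),
      (\dim (sympl_hull D) + (u \notin sympl_dual (sympl_hull C))
       = \dim (sympl_hull C) + (u \in sympl_dual (sympl_hull C)))%N
    & u \in D].
Proof.
move=> vC uv; rewrite {}/D /swap_flag /=; set W := (C :&: _)%VS.
have CE : (W + <[v]>)%VS = C by apply: adjoin_cap_sympl_dual_line.
have uW : u \in sympl_dual W by rewrite memvE sub_sympl_dualC capvSr.
split=> //; first by rewrite -sympl_dualD sympl_dualK CE.
- by rewrite -CE (dim_adjoin uW uv) addSn addnC dim_sympl_dual.
- by rewrite sympl_hull_dual -CE memv_sympl_dual_hull_adjoin // negbK.
- rewrite sympl_hull_dual -CE memv_sympl_dual_hull_adjoin // negbK.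
  by rewrite (dim_sympl_hull_adjoin uW uv).
Qed.

End SymplecticGeometry.

(** * Counting flags *)

Section Counting.

Lemma card_dep_pair (I J : finType) (A : {set I}) (B : I -> {set J}) c :
    (forall i, i \in A -> #|B i| = c) ->
  #|[set p | (p.1 \in A) && (p.2 \in B p.1)]| = (#|A| * c)%N.
Proof.
move=> cardB; rewrite -sum_nat_const -sum1_card.
rewrite (eq_bigl (fun p => (p.1 \in A) && (p.2 \in B p.1))) => [|p]; last first.
  by rewrite inE.
rewrite -(pair_big_dep (mem A) (fun i j => j \in B i) (fun _ _ => 1%N)) /=.
by apply: eq_bigr => i iA; rewrite sum1_card cardB.
Qed.

Variables (F : finFieldType) (n : nat).
Notation V := 'rV[F]_(n + n).
Notation q := #|F|.
Notation A := (num_sympl_hull F n).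
Implicit Types (U W C : {vspace V}) (u v w x y : V).

Lemma card_vspaceD U W :
  (U <= W)%VS -> #|[set x in W | x \notin U]| = (q ^ \dim W - q ^ \dim U)%N.
Proof.
have card_set U' : #|[set x in U']| = (q ^ \dim U')%N.
  by rewrite cardsE card_vspace.
move=> /subvP UW; rewrite -!card_set -(cardsID [set x in U] [set x in W]).
have -> : [set x in W] :&: [set x in U] = [set x in U].
  by apply/setP => x; rewrite !inE andbC; case: (boolP (x \in U)) => //= /UW.
by rewrite addKn; apply: eq_card => x; rewrite !inE andbC.
Qed.

(** Flags (C, (u, v)), sorted by whether cutting C by u enlarges the hull
    (b = true, u orthogonal to the hull) or shrinks it (b = false). *)
Definition sympl_flags k l b : {set {vspace V} * (V * V)} :=
  [set p | [&& \dim p.1 == k, \dim (sympl_hull p.1) == l, p.2.2 \in p.1,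
     sympl_form p.2.1 p.2.2 != 0
     & (p.2.1 \in sympl_dual (sympl_hull p.1)) == b]].

(** For fixed C, the vectors u of a flag are those outside the dual of C and
    inside or outside the dual of the hull, according to b; for each of them
    v ranges over the complement of a hyperplane of C. *)
Lemma card_sympl_flags k l b :
  #|sympl_flags k l b| =
    (A k l * ((if b then q ^ (n + n - l) - q ^ (n + n - k)
               else q ^ (n + n) - q ^ (n + n - l)) * (q ^ k - q ^ k.-1)))%N.
Proof.
pose S C := [set u | (u \notin sympl_dual C)
                     && ((u \in sympl_dual (sympl_hull C)) == b)].
pose T C u := [set v in C | v \notin (C :&: sympl_dual <[u]>)%VS].
pose R C := [set r | (r.1 \in S C) && (r.2 \in T C r.1)].
have -> : sympl_flags k l b
    = [set p | (p.1 \in [set C | (\dim C == k) && (\dim (sympl_hull C) == l)])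
      && (p.2 \in R p.1)].
  apply/setP => -[C [u v]]; rewrite !inE /= memv_cap memv_sympl_dual_line.
  rewrite -!andbA negb_and; do 2!congr andb.
  have [vC|] := boolP (v \in C); last first.
    by rewrite !andbF.
  rewrite /= andbC andbA; have [uv|] := boolP (_ != 0); last by rewrite !andbF.
  rewrite /= !andbT; have -> // : u \notin sympl_dual C.
  by apply: contraNN uv => /memv_sympl_dual/(_ v vC);
    rewrite sympl_form_eq0C => ->.
rewrite (card_dep_pair (B := R)
  (c := ((if b then q ^ (n + n - l) - q ^ (n + n - k)
  else q ^ (n + n) - q ^ (n + n - l)) * (q ^ k - q ^ k.-1))%N)) // => C.
rewrite inE => /andP[/eqP dC /eqP dH].
have -> : (if b then q ^ (n + n - l) - q ^ (n + n - k)
           else q ^ (n + n) - q ^ (n + n - l))%N = #|S C|.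
  have dHd : (\dim (sympl_dual (sympl_hull C)) = n + n - l)%N.
    by have := dim_sympl_dual (sympl_hull C); lia.
  have dCd : (\dim (sympl_dual C) = n + n - k)%N.
    by have := dim_sympl_dual C; lia.
  have sub : (sympl_dual C <= sympl_dual (sympl_hull C))%VS.
    by rewrite sympl_dualS ?capvSl.
  rewrite /S; case: (b).
    rewrite -dHd -dCd -card_vspaceD //; apply: eq_card => u.
    by rewrite !inE eqb_id andbC.
  have := card_vspaceD (subvf (sympl_dual (sympl_hull C))).
  rewrite dim_sympl_space dHd => <-; apply: eq_card => u.
  rewrite !inE memvf /= eqbF_neg; case: (boolP (u \in _)) => //= uH.
    by rewrite andbF.
  by rewrite andbT (contra (subvP sub u)).
rewrite (card_dep_pair (B := T C) (c := (q ^ k - q ^ k.-1)%N)) // => u.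
rewrite inE => /andP[uC _]; rewrite card_vspaceD ?capvSl // dC.
by have := dim_cap_sympl_dual_line C u; rewrite uC dC addn1 => <-.
Qed.

(** Duality is a bijection on subspaces that preserves the hull. *)
Lemma num_sympl_hull_dual k l : (k <= n + n)%N -> A (n + n - k)%N l = A k l.
Proof.
move=> kn; rewrite /num_sympl_hull -(card_imset _ (inv_inj (@sympl_dualK F n))).
apply: eq_card => C; apply/imsetP/idP => [[D + ->]|]; rewrite !inE.
  rewrite sympl_hull_dual => /andP[/eqP dD ->]; rewrite andbT.
  by have := dim_sympl_dual D; lia.
case/andP=> dC dH; exists (sympl_dual C); last by rewrite sympl_dualK.
by rewrite inE sympl_hull_dual dH andbT; have := dim_sympl_dual C; lia.
Qed.

(** The flags whose hull shrinks when C is cut by u go to flags whose hull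
    grows when the swapped space is cut by v, since that cut is the dual of C. *)
Lemma card_swap_flags k l : (k < n + n)%N ->
  #|sympl_flags k.+1 l.+1 false| = #|sympl_flags (n + n - k)%N l true|.
Proof.
move=> kn; have swapK k' l' b :
    {in sympl_flags k' l' b, cancel (@swap_flag F n) (@swap_flag F n)}.
  move=> [C [u v]]; rewrite inE /= => /and5P[_ _ vC uv _].
  by case: (swap_flag_spec vC uv).
rewrite -(card_in_imset (can_in_inj (@swapK _ _ _))); apply: eq_card => p.
apply/imsetP/idP => [[[C [u v]] + ->]|pT].
  rewrite !inE /= => /and5P[/eqP dC /eqP dH vC uv].
  case: (swap_flag_spec vC uv) => _ /= dD -> + ->.
  rewrite eqbF_neg sympl_form_eq0C uv => + uH; rewrite uH (negPf uH) dH /=.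
  by move: dD; rewrite dC /=; lia.
exists (swap_flag p); last by rewrite (swapK _ _ _ _ pT).
case: p pT => C [u v]; rewrite !inE /= => /and5P[/eqP dC /eqP dH vC uv].
case: (swap_flag_spec vC uv) => _ /= dD -> + ->.
rewrite eqb_id sympl_form_eq0C uv => + uH; rewrite uH dH /=.
by move: dD; rewrite dC /=; lia.
Qed.

Lemma num_sympl_hull_up k l : (k < n + n)%N ->
  (A k.+1 l.+1 * ((q ^ (n + n) - q ^ (n + n - l.+1)) * (q ^ k.+1 - q ^ k))
   = A k l * ((q ^ (n + n - l) - q ^ k)
              * (q ^ (n + n - k) - q ^ (n + n - k.+1))))%N.
Proof.
move=> kn; have := card_swap_flags l kn; rewrite !card_sympl_flags /=.
by rewrite num_sympl_hull_dual (subKn (ltnW kn), ltnW kn) // -subnS.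
Qed.

(** This is the previous relation for the dual codes. *)
Lemma num_sympl_hull_down k l : (k < n + n)%N ->
  (A k.+1 l * ((q ^ (n + n - l) - q ^ (n + n - k.+1)) * (q ^ k.+1 - q ^ k))
   = A k l.+1 * ((q ^ (n + n) - q ^ (n + n - l.+1))
              * (q ^ (n + n - k) - q ^ (n + n - k.+1))))%N.
Proof.
move=> kn; have kn' : (n + n - k.+1 < n + n)%N by lia.
have := num_sympl_hull_up l kn'; rewrite -subSn // subSS.
by rewrite !num_sympl_hull_dual ?(ltnW kn) // !subKn ?(ltnW kn).
Qed.

Lemma card_field_gt1 : (1 < q)%N.
Proof. exact: finNzRing_gt1. Qed.

Let pow_lt i j : (i < j)%N -> (q ^ i < q ^ j)%N.
Proof. by move=> ij; rewrite ltn_exp2l // card_field_gt1. Qed.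

Lemma num_sympl_hull_up_gt0 k l :
  (k + l < n + n)%N -> (0 < A k l)%N -> (0 < A k.+1 l.+1)%N.
Proof.
move=> kln Akl; have kn : (k < n + n)%N by lia.
have: (0 < A k.+1 l.+1 * ((q ^ (n + n) - q ^ (n + n - l.+1))
                          * (q ^ k.+1 - q ^ k)))%N.
  by rewrite num_sympl_hull_up // !muln_gt0 Akl !subn_gt0 !pow_lt //; lia.
by rewrite muln_gt0 => /andP[].
Qed.

Lemma num_sympl_hull_down_gt0 k l :
  (k < n + n)%N -> (0 < A k l.+1)%N -> (0 < A k.+1 l)%N.
Proof.
move=> kn Akl.
have: (0 < A k.+1 l * ((q ^ (n + n - l) - q ^ (n + n - k.+1))
                          * (q ^ k.+1 - q ^ k)))%N.
  by rewrite num_sympl_hull_down // !muln_gt0 Akl !subn_gt0 !pow_lt //; lia.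
by rewrite muln_gt0 => /andP[].
Qed.

(** Raising both the dimension and the hull dimension l times from the zero
    code reaches the totally isotropic codes of dimension l; each later pair
    of steps, up and then down, adds two to the dimension alone. *)
Lemma num_sympl_hull_gt0 k l :
    (l <= k)%N -> (k + l <= n + n)%N -> ~~ odd (k - l) ->
  (0 < A k l)%N.
Proof.
move=> lk; have [s -> {k lk}] : exists s, k = (l + s)%N.
  by exists (k - l)%N; lia.
rewrite addKn => bound /even_halfK; rewrite -mul2n => s_eq.
move: bound; rewrite -{}s_eq; elim: s./2 => [|t IHt] bound.
  rewrite muln0 addn0 in bound *; elim: l bound => [|l IHl] bound; last first.
    by apply: num_sympl_hull_up_gt0; [|apply: IHl]; lia.
  apply/card_gt0P; exists 0%VS; rewrite inE dimv0 eqxx /=.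
  have := dimvS (capvSl 0%VS (sympl_dual (0%VS : {vspace V}))).
  by rewrite dimv0 leqn0.
have -> : (l + 2 * t.+1 = (l + 2 * t).+2)%N by lia.
apply: num_sympl_hull_down_gt0; first by lia.
by apply: num_sympl_hull_up_gt0; [|apply: IHt]; lia.
Qed.

(** Both numbers are compared with the number of codes of dimension a + l - 1
    and hull dimension l + 1.  Stating the exponents as a, b, l with
    2n = a + b + 2l keeps the dimensions free of truncated subtraction. *)
Lemma num_sympl_hull_ratio a b l :
    (0 < a)%N -> (0 < b)%N -> (1 < a + b)%N -> (n + n = a + b + (l + l))%N ->
  (A (a + l) l * ((q ^ a - 1) * (q ^ b - 1))
   = A (a + l) l.+2
     * (q ^ (a + b - 2) * ((q ^ l.+1 - 1) * (q ^ l.+2 - 1))))%N.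
Proof.
case: a => // a _; case: b => // b _ _ nE.
have kn : (a + l < n + n)%N by lia.
have := num_sympl_hull_down l kn; have := num_sympl_hull_up l.+1 kn.
rewrite addSn.
move: (A _ l.+2) (A _ l.+1) (A _ l) #|F| card_field_gt1 => A2 A1 A0 p p_gt1.
have powB i j d : i = (j + d)%N -> (p ^ i - p ^ j = p ^ j * (p ^ d - 1))%N.
  by move=> ->; rewrite mulnBr expnD muln1.
have -> : (n + n - l.+2 = a + b + l)%N by lia.
have -> : (n + n - l.+1 = (a + b + l).+1)%N by lia.
have -> : (n + n - l = (a + b + l).+2)%N by lia.
have -> : (n + n - (a + l).+1 = (b + l).+1)%N by lia.
have -> : (n + n - (a + l) = (b + l).+2)%N by lia.
have -> : (a.+1 + b.+1 - 2 = a + b)%N by lia.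
rewrite (powB (n + n)%N (a + b + l)%N l.+2); last by lia.
rewrite (powB (n + n)%N (a + b + l).+1 l.+1); last by lia.
rewrite (powB (a + b + l).+1 (a + l)%N b.+1); last by lia.
rewrite (powB (a + b + l).+2 (b + l).+1 a.+1); last by lia.
rewrite (powB (a + l).+1 (a + l)%N 1%N); last by lia.
rewrite (powB (b + l).+2 (b + l).+1 1%N); last by lia.
have : (0 < p ^ 1 - 1)%N by rewrite subn_gt0.
have [pa_gt0 pb_gt0 pl_gt0] : [/\ 0 < p ^ a, 0 < p ^ b & 0 < p ^ l]%N.
  by rewrite !expn_gt0 (ltnW p_gt1).
have p_gt0 := ltnW p_gt1.
move: (p ^ 1 - 1)%N (p ^ a.+1 - 1)%N (p ^ b.+1 - 1)%N => r x y.
move: (p ^ l.+1 - 1)%N (p ^ l.+2 - 1)%N => z w.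
rewrite !expnS !expnD.
move: (p ^ a)%N (p ^ b)%N (p ^ l)%N pa_gt0 pb_gt0 pl_gt0 => pa pb pl.
move=> pa_gt0 pb_gt0 pl_gt0 r_gt0 up down.
(* The common factor of both sides after eliminating A1 between up and down. *)
apply/eqP; rewrite -(@eqn_pmul2r (pb * pl * p * (pa * pl) * r * (pa * pl))).
  apply/eqP; transitivity
    (A0 * (p * (pb * pl) * x * (pa * pl * r)) * (pa * pl * y))%N; first by ring.
  rewrite down.
  transitivity
    (A1 * (pa * pl * y * (p * (pb * pl) * r)) * (p * (pa * pb * pl) * z))%N;
    first by ring.
  by rewrite -up; ring.
by rewrite !muln_gt0 pa_gt0 pb_gt0 pl_gt0 p_gt0 r_gt0.
Qed.

End Counting.

(** * Comparing the ratio with 1 *)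

Lemma sqr_leq_hull_factor q l :
    (1 < q)%N -> (2 < q)%N || (0 < l)%N ->
  (q ^ 2 <= (q ^ l.+1 - 1) * (q ^ l.+2 - 1))%N.
Proof.
move=> q_gt1 large; have [q_gt2|q_le2] := ltnP 2 q.
  apply: (@leq_trans ((q ^ 1 - 1) * (q ^ 2 - 1))%N); first by nia.
  by rewrite leq_mul // leq_sub2r // leq_pexp2l // ltnW.
have l_gt0 : (0 < l)%N by lia.
apply: (@leq_trans ((q ^ 2 - 1) * (q ^ 3 - 1))%N).
  by have -> : q = 2 by lia.
by rewrite leq_mul // leq_sub2r // leq_pexp2l // ltnW.
Qed.

(** Unless q = 2 and l = 0, the factor is at least q^2, which makes up for the
    2 subtracted in the exponent.  If q = 2 and l = 0, the factor is 3, and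
    a = 2 or b = 2 cancels it against 2^2 - 1. *)
Lemma hull_ratio_gt1 q a b l :
    (1 < q)%N -> (1 < a)%N -> (1 < b)%N ->
    ~~ [&& q == 2, l == 0, 2 < a & 2 < b]%N ->
  ((q ^ a - 1) * (q ^ b - 1)
   < q ^ (a + b - 2) * ((q ^ l.+1 - 1) * (q ^ l.+2 - 1)))%N.
Proof.
move=> q_gt1 a_gt1 b_gt1 regular.
have pow_gt0 i : (0 < q ^ i)%N by rewrite expn_gt0 ltnW.
have [large|small] := boolP ((2 < q) || (0 < l))%N.
  apply: (@leq_trans (q ^ (a + b))); last first.
    rewrite -[X in (_ ^ X <= _)%N](@subnK 2) ?expnD; last by lia.
    by rewrite leq_mul2l sqr_leq_hull_factor ?orbT.
  by rewrite expnD; have := pow_gt0 a; have := pow_gt0 b; nia.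
have [-> ->] : q = 2 /\ l = 0%N by lia.
have [ab|ab] : a = 2 \/ b = 2 by lia.
  by rewrite ab addKn; have := expn_gt0 2 b; lia.
by rewrite ab addnK; have := expn_gt0 2 a; lia.
Qed.

(** With x = 2^a and y = 2^b this is (x - 4)(y - 4) > 12, true as x and y
    are at least 8. *)
Lemma hull_ratio_lt1 a b : (2 < a)%N -> (2 < b)%N ->
  (2 ^ (a + b - 2) * ((2 ^ 1 - 1) * (2 ^ 2 - 1)) < (2 ^ a - 1) * (2 ^ b - 1))%N.
Proof.
move=> a_gt2 b_gt2.
have [[i ->] [j ->]] : (exists i, a = i.+3) /\ (exists j, b = j.+3).
  by split; [exists (a - 3)%N | exists (b - 3)%N]; lia.
have -> : (i.+3 + j.+3 - 2 = i + j + 4)%N by lia.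
rewrite -(addn3 i) -(addn3 j) !expnD.
have := expn_gt0 2 i; have := expn_gt0 2 j.
move: (2 ^ i)%N (2 ^ j)%N => x y /=; nia.
Qed.

(** * Monotonicity *)

Section Comparison.

Variables (F : finFieldType) (n k : nat).
Notation q := #|F|.
Notation A := (num_sympl_hull F n k).

Lemma num_sympl_hull_step l :
    (l + 2 <= k)%N -> (k <= 2 * n - l - 2)%N ->
  (A l * ((q ^ (k - l) - 1) * (q ^ (2 * n - k - l) - 1))
   = A (l + 2)%N * (q ^ (k - l + (2 * n - k - l) - 2)
                  * ((q ^ l.+1 - 1) * (q ^ l.+2 - 1))))%N.
Proof.
move=> lk kn; have := @num_sympl_hull_ratio F n (k - l) (2 * n - k - l) l.
by rewrite subnK ?addn2; [apply | ]; lia.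
Qed.

(** In the range of the recursion the exceptional family is where a and b
    both exceed 2: by parity, these are the conditions 4 <= k <= 2n - 4. *)
Lemma mem_E_S l :
    (l + 2 <= k)%N -> (k <= 2 * n - l - 2)%N -> ~~ odd (k - l) ->
  ((2 * n, k, l, q)%N \in E_S)
    = [&& q == 2, l == 0, 2 < k - l & 2 < 2 * n - k - l]%N.
Proof. by move=> lk kn kl; rewrite unfold_in /=; lia. Qed.

Lemma num_sympl_hull_lt l :
    (l + 2 <= k)%N -> (k <= 2 * n - l - 2)%N -> ~~ odd (k - l) ->
    (2 * n, k, l, q)%N \notin E_S ->
  (A (l + 2)%N < A l)%N.
Proof.
move=> lk kn kl; rewrite mem_E_S // => regular.
have A2_gt0 : (0 < A (l + 2)%N)%N by apply: num_sympl_hull_gt0; lia.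
have := num_sympl_hull_step lk kn.
have : ((q ^ (k - l) - 1) * (q ^ (2 * n - k - l) - 1)
   < q ^ (k - l + (2 * n - k - l) - 2) * ((q ^ l.+1 - 1) * (q ^ l.+2 - 1)))%N.
  by apply: hull_ratio_gt1 => //; [exact: card_field_gt1 | lia | lia].
move: (_ * _)%N (_ * (_ * _))%N => x y xy eqA.
rewrite ltnNge; apply/negP => leA.
have : (A l * x < A (l + 2) * y)%N.
  by apply: leq_ltn_trans (leq_mul leA (leqnn x)) _; rewrite ltn_pmul2l.
by rewrite eqA ltnn.
Qed.

Lemma num_sympl_hull_gt :
  (2 * n, k, 0, q)%N \in E_S -> (A 0 < A 2)%N.
Proof.
move=> exceptional.
have /and3P[k4 kn kl] : [&& 4 <= k, k <= 2 * n - 4 & ~~ odd k]%N.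
  by move: exceptional; rewrite unfold_in /=; lia.
move: exceptional; rewrite mem_E_S; [|lia..] => /and4P[/eqP q2 _ a_gt2 b_gt2].
have A2_gt0 : (0 < A 2)%N by apply: num_sympl_hull_gt0; lia.
have := @num_sympl_hull_step 0 ltac:(lia) ltac:(lia); rewrite q2.
have := hull_ratio_lt1 a_gt2 b_gt2.
move: (_ * _)%N (_ * (_ * _))%N => x y xy eqA.
rewrite ltnNge; apply/negP => leA.
have : (A 2 * y < A 0 * x)%N.
  by apply: leq_trans (leq_mul leA (leqnn x)); rewrite ltn_pmul2l.
by rewrite eqA ltnn.
Qed.

(** Only the first step can be exceptional, since later steps start from a
    positive hull dimension. *)
Lemma num_sympl_hull_decr l l' :
    (l < l')%N -> (l' <= k)%N -> (k + l' <= 2 * n)%N ->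
    ~~ odd (k - l) -> ~~ odd (k - l') ->
    (2 * n, k, l, q)%N \notin E_S ->
  (A l' < A l)%N.
Proof.
move=> ll' l'k kl' evl evl' regular.
have [s l'E] : exists s, l' = (l + 2 + 2 * s)%N.
  by exists ((l' - l) %/ 2 - 1)%N; lia.
rewrite {}l'E in ll' l'k kl' evl' *; elim: s => [|s IHs] in ll' l'k kl' evl' *.
  by rewrite muln0 addn0; apply: num_sympl_hull_lt => //; lia.
apply: ltn_trans (IHs _ _ _ _); try lia.
have -> : (l + 2 + 2 * s.+1 = (l + 2 + 2 * s) + 2)%N by lia.
apply: num_sympl_hull_lt; try lia.
by rewrite unfold_in /=; lia.
Qed.

Lemma num_sympl_ebitsE c l : (l + 2 * c = k)%N -> num_sympl_ebits F n k c = A l.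
Proof.
move=> <-; apply: eq_card => C; rewrite !inE; congr (_ && _).
by rewrite eqn_add2r.
Qed.

End Comparison.

Theorem corollary18 (q : nat) (F : finFieldType) (hq : #|F| = q) (n k : nat) :
  [/\ (* the recursion *)
      forall l : nat,
        (l + 2 <= k)%N -> (k <= 2 * n - l - 2)%N -> ~~ odd (k - l) ->
        (num_sympl_hull F n k l)%:R
        = alphaS n k l q * (q%:R ^+ (l + 1) - 1) * (q%:R ^+ (l + 2) - 1)
          * (num_sympl_hull F n k (l + 2))%:R :> rat,
      (* one step of decrease in l outside E_S *)
      forall l : nat,
        (l + 2 <= k)%N -> (k <= 2 * n - l - 2)%N -> ~~ odd (k - l) ->
        (2 * n, k, l, q)%N \notin E_S ->
        (num_sympl_hull F n k (l + 2) < num_sympl_hull F n k l)%N,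
      (* strictly decreasing in l *)
      forall l l' : nat,
        (l < l')%N -> (l' <= k)%N -> (k + l' <= 2 * n)%N ->
        ~~ odd (k - l) -> ~~ odd (k - l') ->
        (2 * n, k, l, q)%N \notin E_S ->
        (num_sympl_hull F n k l' < num_sympl_hull F n k l)%N,
      (* strictly increasing in c, where l = k - 2c *)
      forall c c' : nat,
        (c < c')%N -> (2 * c' <= k)%N -> (k + (k - 2 * c) <= 2 * n)%N ->
        (2 * n, k, k - 2 * c', q)%N \notin E_S ->
        (num_sympl_ebits F n k c < num_sympl_ebits F n k c')%N
    & (* reversal on E_S, in terms of l and of c *)
      (2 * n, k, 0, q)%N \in E_S ->
        (num_sympl_hull F n k 0 < num_sympl_hull F n k 2)%N
        /\ (num_sympl_ebits F n k (k %/ 2)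
            < num_sympl_ebits F n k ((k - 2) %/ 2))%N].
Proof.
rewrite -{q}hq; split.
- move=> l lk kn _; have q_gt1 := card_field_gt1 F.
  have pow_sub1 i : (#|F|%:R ^+ i - 1 = (#|F| ^ i - 1)%:R :> rat).
    by rewrite natrB ?natrX // expn_gt0 ltnW.
  have pow_sub1_neq0 i : (0 < i)%N -> (#|F|%:R ^+ i - 1 != 0 :> rat).
    move=> i_gt0; rewrite pow_sub1 pnatr_eq0 -lt0n subn_gt0.
    by rewrite -{1}(expn0 #|F|) ltn_exp2l.
  have a0 : (#|F|%:R ^+ (k - l) - 1 != 0 :> rat) by apply: pow_sub1_neq0; lia.
  have b0 : (#|F|%:R ^+ (2 * n - k - l) - 1 != 0 :> rat).
    by apply: pow_sub1_neq0; lia.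
  have := congr1 (fun m : nat => m%:R : rat) (num_sympl_hull_step F lk kn).
  rewrite /= !natrM natrX -!pow_sub1 /alphaS addn1 addn2 => rec.
  apply: (mulIf (mulf_neq0 a0 b0)); rewrite rec.
  by field; rewrite a0 b0.
- exact: num_sympl_hull_lt.
- exact: num_sympl_hull_decr.
- move=> c c' cc' c'k kc regular.
  rewrite (@num_sympl_ebitsE _ _ _ c (k - 2 * c)) 1?subnK //; last by lia.
  rewrite (@num_sympl_ebitsE _ _ _ c' (k - 2 * c')) 1?subnK //.
  by apply: num_sympl_hull_decr => //; lia.
move=> exceptional; have [k4 kl] : (4 <= k)%N /\ ~~ odd k.
  by move: exceptional; rewrite unfold_in /=; lia.
have lt02 := num_sympl_hull_gt exceptional; split=> //.
rewrite (@num_sympl_ebitsE _ _ _ _ 0) ?(@num_sympl_ebitsE _ _ _ _ 2) //; lia.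
Qed.
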